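(* Let $\mathcal X$ be an infinite dimensional linear space over the field $\mathbb K$ of real or complex numbers, of dimension $\aleph$ (the cardinality of a Hamel basis). Then there are at least $2^{\aleph}\cdot\mathfrak c$ many totally non-equivalent norms on $\mathcal X$, where $\mathfrak c$ is the cardinality of $\mathbb R$; that is, there is a set of norms on $\mathcal X$ of cardinality at least $2^{\aleph}\cdot\mathfrak c$, any two distinct members of which are totally non-equivalent.
   Context: Two norms on a linear space are called totally non-equivalent if the topologies they induce are incomparable, i.e. neither topology is contained in the other. *)

(* Defs.v *)
From HB Require Import structures.
From mathcomp Require Import all_boot all_order all_algebra.
From mathcomp Require Import all_classical all_reals topology.
From mathcomp Require Import complex.

Set Implicit Arguments.
Unset Strict Implicit.
Unset Printing Implicit Defensive.

Import Order.TTheory GRing.Theory Num.Theory.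

Local Open Scope classical_set_scope.
Local Open Scope ring_scope.

Definition spans (K : numFieldType) (X : lmodType K) (B : set X) : Prop :=
  forall x : X, exists (s : seq X) (a : X -> K),
    (forall b, b \in s -> B b) /\ x = \sum_(b <- s) a b *: b.

Definition linearly_independent (K : numFieldType) (X : lmodType K)
    (B : set X) : Prop :=
  forall (s : seq X) (a : X -> K), uniq s -> (forall b, b \in s -> B b) ->
    \sum_(b <- s) a b *: b = 0 -> forall b, b \in s -> a b = 0.

Definition hamel_basis (K : numFieldType) (X : lmodType K) (B : set X) : Prop :=
  linearly_independent B /\ spans B.

(* As for normedModType K, norms take their values in K itself. For K = R[i],
   0 <= z says that z is real and nonnegative, so norms are real-valued. *)
Record is_norm (K : numFieldType) (X : lmodType K) (N : X -> K) : Prop := {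
  is_norm_ge0 : forall x, 0 <= N x;
  is_norm_eq0 : forall x, N x = 0 -> x = 0;
  is_normZ : forall (a : K) x, N (a *: x) = `|a| * N x;
  is_normD : forall x y, N (x + y) <= N x + N y }.

Definition norm_topology (K : numFieldType) (X : lmodType K) (N : X -> K) :
    set (set X) :=
  [set U | forall x, U x -> nbhs_ball_ (ball_ N) x U].

Definition totally_nonequivalent (K : numFieldType) (X : lmodType K)
    (N1 N2 : X -> K) : Prop :=
  ~ (norm_topology N1 `<=` norm_topology N2) /\
  ~ (norm_topology N2 `<=` norm_topology N1).

Definition subsets (T : Type) (B : set T) : set (set T) := [set A | A `<=` B].

(* Main.v *)
(** In the coordinates x_b of a Hamel basis B, a weight w : B -> {1, 2, ...}
    gives the norm N_w x = sum_b |x_b| w b, and the topology of N_w is contained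
    in that of N_w' only if w / w' is bounded on B. Since |B| * aleph_0 = |B|, each
    element of B owns an infinite sequence inside B, the sequences being
    disjoint. For A included in B, let w_A be unbounded on the terms of even or
    of odd index of the sequence of c, according to whether c is in A, and 1 on
    the other terms. Distinct A give totally non-equivalent norms, and
    2^|B| * |R| = 2^|B|. *)

Require Import Defs.
From HB Require Import structures.
From mathcomp Require Import all_boot all_order all_algebra.
From mathcomp Require Import all_classical all_reals topology complex.

Set Implicit Arguments.
Unset Strict Implicit.
Unset Printing Implicit Defensive.

Import Order.TTheory GRing.Theory Num.Theory.

Local Open Scope classical_set_scope.
Local Open Scope card_scope.
Local Open Scope ring_scope.

(** * Cardinal arithmetic of an infinite set and of its power set *)

Lemma card_le_inj (T U : Type) (A : set T) (B : set U) (f : T -> U) :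
  (forall x, A x -> B (f x)) ->
  (forall x y, A x -> A y -> f x = f y -> x = y) -> A #<= B.
Proof.
move=> fAB finj.
have fA : f @` A #= A.
  by apply: inj_card_eq => x y /set_mem Ax /set_mem Ay; exact: finj.
rewrite -(card_le_eql fA); apply: subset_card_le => _ [x Ax <-]; exact: fAB.
Qed.

Lemma infinite_set_inj (T : Type) (A : set T) : infinite_set A ->
  exists f : nat -> T, injective f /\ forall n, A (f n).
Proof.
move=> /infiniteP/card_leP[g].
pose u (n : nat) : [set: nat] := SigSub (mem_setT n).
exists (fun n => val (g (u n))); split => [m n /val_inj|n]; last exact: set_valP.
move=> guv.
by have /(congr1 val) := @inj _ _ _ g (u m) (u n) (mem_set I) (mem_set I) guv.
Qed.

(* Zorn's lemma splits B into countably infinite sets and a finite rest, which is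
   absorbed by one of the countable pieces. *)
Lemma infinite_set_mul_nat (T : Type) (B : set T) : infinite_set B ->
  exists phi : T -> nat -> T, (forall b n, B b -> B (phi b n)) /\
    forall b b' n n', B b -> B b' -> phi b n = phi b' n' -> b = b' /\ n = n'.
Proof.
move=> Binf.
pose P : set (set (nat -> T)) := [set F : set (nat -> T) |
  (forall f, F f -> injective f /\ forall n, B (f n)) /\
  (forall f g n m, F f -> F g -> f n = g m -> f = g)].
have [|F [[Finj Fdisj] Fmax]] := @Zorn_bigcup _ P.
  move=> C CP Ctot; split => [f [F CF Ff]|f g n m [F CF Ff] [G CG Gg]].
    exact: (CP F CF).1.
  by have [FG|GF] := Ctot F G CF CG;
    [apply: (CP G CG).2 => //; exact: FG|apply: (CP F CF).2 => //; exact: GF].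
pose U : set T := [set x | exists f n, F f /\ f n = x].
(* An infinite rest would contain one more injective sequence [h], disjoint from all those in [F],
   against maximality. *)
have restfin : finite_set (B `\` U).
  apply: contrapT => /infinite_set_inj [h [hinj hBU]].
  apply: (Fmax (F `|` [set h])).
    split; first by move=> f; left.
    move=> /(_ h (or_intror erefl)) Fh.
    by have [_] := hBU 0%N; apply; exists h, 0%N.
  have hF f n m : F f -> f n = h m -> False.
    by move=> Ff fh; have [_] := hBU m; apply; exists f, n.
  split => [f [/Finj//|->]|f g n m [Ff|->] [Fg|->]//].
  - by split => // n; have [] := hBU n.
  - exact: Fdisj.
  - by move=> /hF -/(_ Ff).
  - by move=> /esym /hF -/(_ Fg).
have [f0 Ff0] : exists f, F f.
  apply: contrapT => noF; apply: Binf; apply: sub_finite_set restfin => x Bx.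
  by split => // -[f [n [Ff _]]]; apply: noF; exists f.
have /countable_injP[e einj] := finite_set_countable restfin.
(* A code is a sequence with a slot number. The [n]-th term of a sequence takes the even slot [n.*2]
   of it; the leftover points take odd slots of [f0], so that parity separates the two kinds. *)
pose Q x (p : (nat -> T) * nat) := F p.1 /\
  ((exists n, p.2 = n.*2 /\ p.1 n = x) \/
   ((B `\` U) x /\ p.1 = f0 /\ p.2 = (e x).*2.+1)).
have [code codeP] : exists code, forall x, B x -> Q x (code x).
  have : forall x, exists p, B x -> Q x p.
    move=> x; have [[f [n [Ff fx]]]|nUx] := pselect (U x).
      by exists (f, n.*2) => _; split => //; left; exists n.
    by exists (f0, (e x).*2.+1) => Bx; split => //; right.
  by move=> /choice [code]; exists code.
(* Pairing of naturals cuts each sequence of [F] into countably many disjoint subsequences, one per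
   slot. The point [b] owns the one named by its code. *)
exists (fun b n => (code b).1 (pickle ((code b).2, n))); split.
  by move=> b n /codeP [/Finj []].
move=> b b' n n' Bb Bb' eq_phi.
have [Fb cb] := codeP b Bb; have [Fb' cb'] := codeP b' Bb'.
have eqf := Fdisj _ _ _ _ Fb Fb' eq_phi.
have /(pcan_inj pickleK) [eqk ->] :
    pickle ((code b).2, n) = pickle ((code b').2, n').
  by apply: (Finj _ Fb).1; rewrite eq_phi eqf.
split=> //.
case: cb => [[m [cbm <-]]|[rb [_ cbm]]]; case: cb' => [[m' [cbm' <-]]|[rb' [_ cbm']]].
- by rewrite eqf; congr (_ _); apply: double_inj; rewrite -cbm -cbm'.
- by have := congr1 odd eqk; rewrite cbm cbm' /= !odd_double.
- by have := congr1 odd eqk; rewrite cbm cbm' /= !odd_double.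
- move: eqk; rewrite cbm cbm' => -[/double_inj] /einj.
  by rewrite !inE; apply.
Qed.

(* A real r is encoded by its cut {q rational | q < r}, a subset of a countable
   part of B disjoint from the copy of B that carries A. *)
Lemma subsets_setX_reals (R : realType) (T : Type) (B : set T) :
  infinite_set B -> subsets B `*` [set: R] #<= subsets B.
Proof.
move=> Binf; have [b0 Bb0] := infinite_setN0 Binf.
have [phi [phiB phi_inj]] := infinite_set_mul_nat Binf.
(* Index 0 is kept for the copy of [A]; the shift [.+1] in [D] keeps the cut away from it, even on
   the sequence of [b0]. *)
pose L (A : set T) := [set phi a 0%N | a in A].
pose D (r : R) :=
  [set phi b0 (pickle q).+1 | q in [set q : rat | ratr q < r]].
apply: (@card_le_inj _ _ _ _ (fun p => L p.1 `|` D p.2)).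
  by move=> [A r] [/= AB _] x [[a /AB Ba <-]|[q _ <-]]; exact: phiB.
move=> [A r] [A' r'] [/= AB _] [/= AB' _] eqLD.
have subA C C' s s' : C `<=` B -> C' `<=` B ->
    L C `|` D s = L C' `|` D s' -> C `<=` C'.
  move=> CB CB' eqC a Ca.
  have : (L C' `|` D s') (phi a 0%N) by rewrite -eqC; left; exists a.
  move=> [[a' Ca' eqphi]|[q _ eqphi]].
    by have [<-] := phi_inj _ _ _ _ (CB' _ Ca') (CB _ Ca) eqphi.
  by have [] := phi_inj _ _ _ _ Bb0 (CB _ Ca) eqphi.
have subr C C' s s' : C `<=` B -> C' `<=` B ->
    L C `|` D s = L C' `|` D s' -> s <= s'.
  move=> CB CB' eqC; rewrite leNgt; apply/negP => /rat_in_itvoo [q].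
  rewrite in_itv /= => /andP[s'q qs].
  have : (L C' `|` D s') (phi b0 (pickle q).+1) by rewrite -eqC; right; exists q.
  move=> [[a' Ca' eqphi]|[q' /= q's' eqphi]].
    by have [] := phi_inj _ _ _ _ (CB' _ Ca') Bb0 eqphi.
  have [_ [/(pcan_inj pickleK) qq']] := phi_inj _ _ _ _ Bb0 Bb0 eqphi.
  move: q's'; rewrite qq' => qs'.
  by have := lt_trans s'q qs'; rewrite ltxx.
congr pair.
  by apply/seteqP; split; [apply: subA eqLD|apply: subA (esym eqLD)].
by apply/eqP; rewrite eq_le (subr _ _ _ _ AB AB' eqLD) (subr _ _ _ _ AB' AB (esym eqLD)).
Qed.

(** * Coordinates in a Hamel basis and weighted sum norms *)

Lemma sum_widen_seq (I : eqType) (V : nmodType) (s t : seq I) (F : I -> V) :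
  uniq s -> uniq t -> {subset s <= t} ->
  (forall b, b \notin s -> F b = 0) -> \sum_(b <- s) F b = \sum_(b <- t) F b.
Proof.
move=> us ut st F0; rewrite [RHS](bigID (mem s)) /= [X in _ + X]big1 // addr0.
rewrite -[RHS]big_filter; apply: perm_big; apply: uniq_perm => //.
  exact: filter_uniq.
by move=> b; rewrite mem_filter; case: (boolP (b \in s)) => // /st ->.
Qed.

Section WeightedNorm.
Variables (K : numFieldType) (X : lmodType K) (B : set X).

Lemma spans_coord : spans B -> exists (supp : X -> seq X) (c : X -> X -> K),
  forall x, [/\ uniq (supp x), forall b, b \in supp x -> B b,
    forall b, b \notin supp x -> c x b = 0 &
    x = \sum_(b <- supp x) c x b *: b].
Proof.
move=> spanB.
have : forall x, exists p : seq X * (X -> K), [/\ uniq p.1,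
    forall b, b \in p.1 -> B b, forall b, b \notin p.1 -> p.2 b = 0 &
    x = \sum_(b <- p.1) p.2 b *: b].
  move=> x; have [s [a [sB xE]]] := spanB x.
  (* The list given by [spans] may repeat vectors, so each coefficient is multiplied by the number
     of occurrences. The value 0 off the list makes the coordinates total functions. *)
  exists (undup s, fun b => if b \in s then a b *+ count_mem b s else 0).
  split => /= [|b|b|]; rewrite ?undup_uniq ?mem_undup //.
  - exact: sB.
  - by move=> /negPf ->.
  rewrite xE -big_undup_iterop_count; apply: eq_big_seq => b.
  by rewrite mem_undup => ->; rewrite -[iterop _ _ _ _]/(_ *+ _) scalerMnl.
by move=> /choice [p pP]; exists (fun x => (p x).1), (fun x => (p x).2).
Qed.

Hypothesis hB : hamel_basis B.

Lemma sum_scale_inj (s : seq X) (a a' : X -> K) :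
  uniq s -> (forall b, b \in s -> B b) ->
  \sum_(b <- s) a b *: b = \sum_(b <- s) a' b *: b ->
  forall b, b \in s -> a b = a' b.
Proof.
move=> us sB eqs b bs; apply/eqP; rewrite -subr_eq0; apply/eqP.
apply: (hB.1 s (fun b => a b - a' b) us sB _ _ bs).
under eq_bigr do rewrite scalerBl.
by rewrite sumrB eqs subrr.
Qed.

Let supp := projT1 (cid (spans_coord hB.2)).
Let c := projT1 (cid (projT2 (cid (spans_coord hB.2)))).
Let cP x : [/\ uniq (supp x), forall b, b \in supp x -> B b,
    forall b, b \notin supp x -> c x b = 0 &
    x = \sum_(b <- supp x) c x b *: b].
Proof. exact: (projT2 (cid (projT2 (cid (spans_coord hB.2))))). Qed.

(** The chosen list [supp x] may contain vectors of zero coordinate and has no prescribed relation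
    to [supp] of other vectors. Sums are therefore compared on a common larger list. *)
Let sum_supp (V : nmodType) x (t : seq X) (F : X -> V) :
  uniq t -> {subset supp x <= t} -> (forall b, c x b = 0 -> F b = 0) ->
  \sum_(b <- supp x) F b = \sum_(b <- t) F b.
Proof.
move=> ut st F0; have [us _ c0 _] := cP x.
by apply: sum_widen_seq => // b /c0 /F0.
Qed.

(** Uniqueness of coordinates: both expansions of [x] are carried to one duplicate-free list, where
    linear independence applies. Linearity of [c] and its values on the basis follow. *)
Let coord_eq x (s : seq X) (a : X -> K) : uniq s -> (forall b, b \in s -> B b) ->
  (forall b, b \notin s -> a b = 0) -> x = \sum_(b <- s) a b *: b -> c x =1 a.
Proof.
move=> us sB a0 xE b.
have [ux xB c0 xE'] := cP x.
pose t := undup (supp x ++ s).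
have tP y : (y \in t) = (y \in supp x) || (y \in s).
  by rewrite mem_undup mem_cat.
have [bt|] := boolP (b \in t); last first.
  by rewrite tP negb_or => /andP[/c0 -> /a0 ->].
apply: (@sum_scale_inj t) bt; first exact: undup_uniq.
  by move=> y; rewrite tP => /orP[/xB|/sB].
rewrite -(@sum_supp _ x t) ?undup_uniq //; last 2 first.
- by move=> y yx; rewrite tP yx.
- by move=> y ->; rewrite scale0r.
rewrite -xE' {1}xE; apply: sum_widen_seq => //; first exact: undup_uniq.
  by move=> y ys; rewrite tP ys orbT.
by move=> y /a0 ->; rewrite scale0r.
Qed.

Let coordD x y b : c (x + y) b = c x b + c y b.
Proof.
have [ux xB cx0 xE] := cP x; have [uy yB cy0 yE] := cP y.
pose t := undup (supp x ++ supp y).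
have tP z : (z \in t) = (z \in supp x) || (z \in supp y).
  by rewrite mem_undup mem_cat.
apply: (@coord_eq _ t (fun b => c x b + c y b)); first exact: undup_uniq.
- by move=> z; rewrite tP => /orP[/xB|/yB].
- by move=> z; rewrite tP negb_or => /andP[/cx0 -> /cy0 ->]; rewrite addr0.
under eq_bigr do rewrite scalerDl.
rewrite big_split /= -(@sum_supp _ x t) ?undup_uniq //; last 2 first.
- by move=> z zx; rewrite tP zx.
- by move=> z ->; rewrite scale0r.
rewrite -(@sum_supp _ y t) ?undup_uniq //; last 2 first.
- by move=> z zx; rewrite tP zx orbT.
- by move=> z ->; rewrite scale0r.
by rewrite -xE -yE.
Qed.

Let coordZ a x b : c (a *: x) b = a * c x b.
Proof.
have [ux xB cx0 xE] := cP x.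
apply: (@coord_eq _ (supp x) (fun b => a * c x b)) => //.
  by move=> z /cx0 ->; rewrite mulr0.
by rewrite [in LHS]xE scaler_sumr; under eq_bigr do rewrite scalerA.
Qed.

Let coord_basis b : B b -> forall b', c b b' = (b' == b)%:R.
Proof.
move=> Bb; apply: (@coord_eq _ [:: b]) => //.
- by move=> z; rewrite inE => /eqP ->.
- by move=> z; rewrite inE => /negPf ->.
- by rewrite big_seq1 eqxx scale1r.
Qed.

Definition weighted_norm (w : X -> nat) (x : X) : K :=
  \sum_(b <- supp x) `|c x b| * (w b)%:R.

Lemma weighted_norm_basis w b : B b -> weighted_norm w b = (w b)%:R.
Proof.
move=> Bb; rewrite /weighted_norm.
(* Since [supp b] need not be the list [[:: b]], the sum is first widened to contain [b], then cut
   down to [b] alone. *)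
rewrite (@sum_supp _ b (undup (b :: supp b))) ?undup_uniq //; last 2 first.
- by move=> y yx; rewrite mem_undup inE yx orbT.
- by move=> y ->; rewrite normr0 mul0r.
rewrite -(@sum_widen_seq _ _ [:: b]) ?undup_uniq //.
- by rewrite big_seq1 coord_basis // eqxx normr1 mul1r.
- by move=> y; rewrite inE mem_undup inE => ->.
- by move=> y; rewrite inE coord_basis // => /negPf ->; rewrite normr0 mul0r.
Qed.

Lemma weighted_norm_is_norm w : (forall b, 0 < w b)%N -> is_norm (weighted_norm w).
Proof.
move=> w0; split.
- by move=> x; apply: sumr_ge0 => b _; rewrite mulr_ge0.
- move=> x /eqP; rewrite psumr_eq0 => [/allP cx0|b _]; last by rewrite mulr_ge0.
  have [_ _ _ ->] := cP x; apply: big1_seq => b /andP[_ /cx0].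
  by rewrite mulf_eq0 normr_eq0 pnatr_eq0 eqn0Ngt w0 orbF => /eqP ->; rewrite scale0r.
- move=> a x; rewrite /weighted_norm.
  have [-> |an0] := eqVneq a 0.
    by rewrite normr0 mul0r big1 // => b _; rewrite coordZ mul0r normr0 mul0r.
  pose t := undup (supp x ++ supp (a *: x)).
  have tP z : (z \in t) = (z \in supp x) || (z \in supp (a *: x)).
    by rewrite mem_undup mem_cat.
  rewrite (@sum_supp _ _ t) ?undup_uniq //; last 2 first.
  + by move=> z zx; rewrite tP zx orbT.
  + by move=> z ->; rewrite normr0 mul0r.
  rewrite (@sum_supp _ x t) ?undup_uniq //; last 2 first.
  + by move=> z zx; rewrite tP zx.
  + by move=> z ->; rewrite normr0 mul0r.
  by rewrite mulr_sumr; apply: eq_bigr => b _; rewrite coordZ normrM mulrA.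
- move=> x y; rewrite /weighted_norm.
  pose t := undup (supp x ++ supp y ++ supp (x + y)).
  have tP z : (z \in t) = [|| z \in supp x, z \in supp y | z \in supp (x + y)].
    by rewrite mem_undup !mem_cat.
  rewrite (@sum_supp _ (x + y) t) ?undup_uniq //; last 2 first.
  + by move=> z zx; rewrite tP zx !orbT.
  + by move=> z ->; rewrite normr0 mul0r.
  rewrite (@sum_supp _ x t) ?undup_uniq //; last 2 first.
  + by move=> z zx; rewrite tP zx.
  + by move=> z ->; rewrite normr0 mul0r.
  rewrite (@sum_supp _ y t) ?undup_uniq //; last 2 first.
  + by move=> z zx; rewrite tP zx orbT.
  + by move=> z ->; rewrite normr0 mul0r.
  rewrite -big_split /=; apply: ler_sum => b _.
  by rewrite coordD -mulrDl ler_wpM2r // ler_normD.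
Qed.

End WeightedNorm.

(** * Inclusion of norm topologies *)

(** The open unit ball of [N1] is a neighbourhood of 0 for [N2], so it contains an [N2]-ball of some
    radius [e]; homogeneity then gives the constant [2 / e]. *)
Lemma norm_topology_sub_le (K : numFieldType) (X : lmodType K) (N1 N2 : X -> K) :
  is_norm N1 -> is_norm N2 -> norm_topology N1 `<=` norm_topology N2 ->
  exists C : K, forall x, N1 x <= C * N2 x.
Proof.
move=> n1 n2 sub12.
have N0 : N1 0 = 0 by rewrite -(scale0r 0) (is_normZ n1) normr0 mul0r.
have /sub12 /(_ 0) : norm_topology N1 [set x | N1 x < 1].
  move=> x /= x1; exists (1 - N1 x); first by rewrite /= subr_gt0.
  move=> y /=; rewrite ltrBrDr => xy.
  apply: le_lt_trans xy.
  have -> : N1 (x - y) = N1 (y - x).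
    by rewrite -opprB -scaleN1r (is_normZ n1) normrN1 mul1r.
  by apply: le_trans (is_normD n1 _ _); rewrite subrK.
rewrite /= N0 ltr01 => /(_ isT) [e /= e0 eN].
exists (2 / e) => x.
have [->|xn0] := eqVneq x 0.
  by rewrite N0 mulr_ge0 ?divr_ge0 ?(is_norm_ge0 n2) // ltW.
have N2x : 0 < N2 x.
  rewrite lt_def (is_norm_ge0 n2) andbT; apply/eqP => /(is_norm_eq0 n2) x0.
  by rewrite x0 eqxx in xn0.
(* With this factor [t *: x] has [N2]-norm [e / 2], strictly inside the ball. *)
pose t := e / 2 / N2 x.
have t0 : 0 < t by rewrite !divr_gt0.
(* The ball around 0 measures [0 - y], whence the minus sign. *)
have : N1 (- t *: x) < 1.
  apply: eN => /=; rewrite sub0r scaleNr opprK (is_normZ n2) gtr0_norm //.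
  by rewrite /t divfK ?gt_eqF // ltr_pdivrMr // ltr_pMr // ltr1n.
rewrite (is_normZ n1) normrN gtr0_norm // => /ltW.
rewrite -ler_pdivlMl // mulr1 /t !invf_div mulrA [2 / e * _]mulrC.
by rewrite -mulrA mulrC.
Qed.

(** * Weights with unbounded ratios *)

Lemma unbounded_weights (T : Type) (B : set T) : infinite_set B ->
  exists w : set T -> T -> nat, (forall A b, 0 < w A b)%N /\
    forall A A', A `<=` B -> A' `<=` B -> A <> A' ->
      forall n, exists2 b, B b & (n * w A' b < w A b)%N.
Proof.
move=> /infinite_set_mul_nat [phi [phiB phi_inj]].
(* [psi] recovers owner and index of a term; its value [(x, 0)] off the sequences is arbitrary. *)
have [psi psiK] : exists psi : T -> T * nat,
    forall b n, B b -> psi (phi b n) = (b, n).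
  have /choice[psi psiP] : forall x, exists p : T * nat,
      forall b n, B b -> phi b n = x -> p = (b, n).
    move=> x; have [[b [n [Bb <-]]]|no] := pselect (exists b n, B b /\ phi b n = x).
      by exists (b, n) => b' n' Bb' /(phi_inj _ _ _ _ Bb' Bb) [-> ->].
    by exists (x, 0%N) => b n Bb bx; case: no; exists b, n.
  by exists psi => b n Bb; exact: psiP.
exists (fun A x => if `[< A (psi x).1 >] == odd (psi x).2
                   then (psi x).2.+1 else 1%N); split=> [A b|A A' AB A'B AA' n].
  by case: ifP.
have [c Bc Ac] : exists2 c, B c & `[< A c >] != `[< A' c >].
  apply: contrapT => no; apply: AA'; apply/seteqP.
  have eqA c : B c -> A c <-> A' c.
    move=> Bc; apply: asbool_eq_equiv; apply: contrapT => /eqP Ac.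
    by apply: no; exists c.
  by split=> c => [/[dup]/AB/eqA[+ _]|/[dup]/A'B/eqA[_ +]]; apply.
(* The added bit gives the index the parity on which [w A] is the index plus one. As [A] and [A']
   disagree at [c], [w A'] is 1 there, and doubling makes the index at least [n]. *)
exists (phi c (n.*2 + `[< A c >])%N); first exact: phiB.
rewrite psiK //= oddD odd_double /= oddb eqxx eq_sym (negPf Ac) muln1 ltnS.
by rewrite -addnn -addnA leq_addr.
Qed.

(** * The family of norms, over the reals and the complex numbers *)

(** The Archimedean hypothesis treats both scalar fields at once: it replaces a constant in [K] by a
    natural number, to be beaten by a ratio of weights. *)
Lemma many_totally_nonequivalent_norms (R : realType) (K : numFieldType)
    (X : lmodType K) (B : set X) :
  (forall x : K, exists n : nat, `|x| < n%:R) ->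
  hamel_basis B -> infinite_set B ->
  exists S : set (X -> K),
    [/\ forall N, S N -> is_norm N,
        forall N1 N2, S N1 -> S N2 -> N1 <> N2 -> totally_nonequivalent N1 N2
      & subsets B `*` [set: R] #<= S].
Proof.
move=> archK hB Binf; have [w [w0 wP]] := unbounded_weights Binf.
pose N A := weighted_norm hB (w A).
have normN A : is_norm (N A) by exact: weighted_norm_is_norm.
have sepN A A' : A `<=` B -> A' `<=` B -> A <> A' ->
    ~ norm_topology (N A) `<=` norm_topology (N A').
  move=> AB A'B AA' /(norm_topology_sub_le (normN A) (normN A')) [C CP].
  have [n Cn] := archK C; have [b Bb] := wP _ _ AB A'B AA' n.
  rewrite ltnNge -(ler_nat K) => /negP; apply; rewrite natrM.
  have := CP b; rewrite /N !weighted_norm_basis // => le_w.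
  (* The sign of [C] is not given, but this product dominates a weight; it thus equals its own
     absolute value, which is at most [n * w A' b]. *)
  have Cw : 0 <= C * (w A' b)%:R by exact: le_trans le_w.
  apply: le_trans le_w _; rewrite -(ger0_norm Cw) normrM normr_nat.
  by rewrite ler_wpM2r // ltW.
exists (N @` subsets B); split=> [_ [A _ <-]//|_ _ [A AB <-] [A' A'B <-] NN'|].
  have AA' : A <> A' by move=> AA'; apply: NN'; rewrite AA'.
  by split; apply: sepN => //; exact: nesym.
apply: card_le_trans (subsets_setX_reals R Binf) _.
apply: (card_le_inj (f := N)) => [A AB|A A' AB A'B NN']; first by exists A.
(* Distinct sets give distinct norms, since a topology is contained in itself. *)
by apply: contrapT => /(sepN _ _ AB A'B); apply; rewrite NN'.
Qed.

Theorem corollary6p10 (R : realType) :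
  (forall (X : lmodType R) (B : set X),
     hamel_basis B -> infinite_set B ->
     exists S : set (X -> R),
       [/\ forall N, S N -> is_norm N,
           forall N1 N2, S N1 -> S N2 -> N1 <> N2 -> totally_nonequivalent N1 N2
         & subsets B `*` [set: R] #<= S]) /\
  (forall (X : lmodType R[i]) (B : set X),
     hamel_basis B -> infinite_set B ->
     exists S : set (X -> R[i]),
       [/\ forall N, S N -> is_norm N,
           forall N1 N2, S N1 -> S N2 -> N1 <> N2 -> totally_nonequivalent N1 N2
         & subsets B `*` [set: R] #<= S]).
Proof.
have archR (x : R) : 0 <= x -> exists n : nat, x < n%:R.
  by move=> /archi_boundP; exists (Num.bound x).
split=> X B; apply: many_totally_nonequivalent_norms => x.
  exact: archR (normr_ge0 x).
(* The complex modulus is the image of a real number, so the bound is found in [R]. *)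
have := normr_ge0 x; rewrite normc_def lecR => /archR [n xn].
by exists n; rewrite -(rmorph_nat (real_complex R)) ltcR.
Qed.
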